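(* Let $1\le k\le n$ and let $\lambda=(\lambda_1,\dots,\lambda_n)\in\Gamma_k$ with $\lambda_1<0$. Then $$\sigma_m(\lambda|1)\ \ge\ \sigma_m(\lambda)\qquad\text{for all } m=0,1,\dots,k.$$ Moreover, for every integer $l$ with $0\le l<k$, $$\frac{\partial}{\partial\lambda_1}\left[\frac{\sigma_k(\lambda)}{\sigma_l(\lambda)}\right]\ \ge\ \frac{n}{k}\,\frac{k-l}{n-l}\,\frac{1}{n-k+1}\sum_{i=1}^n\frac{\partial}{\partial\lambda_i}\left[\frac{\sigma_k(\lambda)}{\sigma_l(\lambda)}\right].$$
   Context: For $\lambda\in\mathbb{R}^n$, $\sigma_j(\lambda)=\sum_{1\le i_1<\cdots<i_j\le n}\lambda_{i_1}\cdots\lambda_{i_j}$ and $\sigma_0=1$. $\sigma_m(\lambda|i)$ denotes $\sigma_m(\lambda)$ with $\lambda_i$ set equal to $0$. $\Gamma_k=\{\lambda\in\mathbb{R}^n:\sigma_i(\lambda)>0 \text{ for all } 1\le i\le k\}$. *)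

(* Defs.v *)
From HB Require Import structures.
From mathcomp Require Import all_boot all_order all_algebra.
From mathcomp Require Import all_classical all_reals all_analysis.
Set Implicit Arguments.
Unset Strict Implicit.
Unset Printing Implicit Defensive.
Import Order.TTheory GRing.Theory Num.Theory.
Import numFieldNormedType.Exports.

Local Open Scope classical_set_scope.
Local Open Scope ring_scope.

(* Increasing j-tuples of indices are encoded as j-element subsets of 'I_n. *)
Definition sigma (R : realType) (n j : nat) (x : 'rV[R]_n) : R :=
  \sum_(A : {set 'I_n} | #|A| == j) \prod_(i in A) x 0 i.

Definition zero_at (R : realType) (n : nat) (i : 'I_n) (x : 'rV[R]_n) :
    'rV[R]_n :=
  \row_p (if p == i then 0 else x 0 p).

(* sigma_m(x|i) *)
Definition sigma_drop (R : realType) (n m : nat) (x : 'rV[R]_n) (i : 'I_n) : R :=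
  sigma m (zero_at i x).

Definition Gamma (R : realType) (n k : nat) : set 'rV[R]_n :=
  [set x | forall i : nat, (1 <= i <= k)%N -> 0 < sigma i x].

Definition partial (R : realType) (n : nat) (i : 'I_n) (f : 'rV[R]_n -> R)
    (x : 'rV[R]_n) : R :=
  'D_(delta_mx 0 i) f x.

(* Main.v *)
Require Import Defs.
From HB Require Import structures.
From mathcomp Require Import all_boot all_order all_algebra.
From mathcomp Require Import all_classical all_reals all_analysis.
From mathcomp Require Import zify ring lra.
From mathcomp Require Import complex.
Set Implicit Arguments.
Unset Strict Implicit.
Unset Printing Implicit Defensive.
Import Order.TTheory GRing.Theory Num.Theory.
Import numFieldNormedType.Exports.

Local Open Scope classical_set_scope.
Local Open Scope ring_scope.

(** Write s_m = sigma_m(x), t_m = sigma_m(x|1) and t_(-1) = 0.  Everything rests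
    on s_m = t_m + x_1 t_(m-1).  As x_1 < 0 and s_m > 0 for m <= k, an induction
    on m gives t_m > 0 for m <= k, hence also t_m >= s_m.

    The partial derivative of s_m in the i-th variable is sigma_(m-1)(x|i), so
    the numerator of the derivative of s_k / s_l in x_1 is
      t_(k-1) s_l - s_k t_(l-1) = t_(k-1) t_l - t_k t_(l-1),
    while the sum over i of these numerators is at most
    (n-k+1) s_(k-1) s_l, the other term being a product of nonnegative factors
    with a minus sign.  Since s_(k-1) s_l <= t_(k-1) t_l, it suffices that
      t_k t_(l-1) <= l (n-k) / (k (n-l)) t_(k-1) t_l,
    because 1 - l (n-k) / (k (n-l)) = n (k-l) / (k (n-l)) is the constant
    of the statement once the factor n-k+1 has cancelled.  This is a chain of Newton inequalities
    ([newton_ineq], [ratio_chain]) for the n-1 numbers other than x_1.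

    Newton's inequality for arbitrary real numbers a_1, ..., a_N is read off the
    real-rooted polynomial prod (1 + a_i X), whose coefficients are the
    elementary symmetric functions e_j.  Differentiation and reversal of
    the coefficients preserve real-rootedness ([real_rooted_deriv],
    [real_rooted_rev_poly]); j derivatives, a reversal and N-j-2 more derivatives
    leave a quadratic whose coefficients are positive multiples of e_j, e_(j+1),
    e_(j+2), and its discriminant is nonnegative.  That the derivative of a
    real-rooted polynomial is real-rooted is proved over the complex numbers by the
    Gauss-Lucas argument, where multiple roots need no special care. *)

(** * Real-rooted polynomials *)

(** The zero polynomial is included, so that the notion is stable under
    derivation without any condition on the degree. *)
Definition real_rooted (C : numClosedFieldType) (p : {poly C}) : Prop :=
  p != 0 -> forall z : C, root p z -> z \is Num.real.

Lemma horner_deriv_prod_XsubC (F : fieldType) (r : seq F) (z : F) :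
  z \notin r ->
  (\prod_(a <- r) ('X - a%:P))^`().[z] =
  (\prod_(a <- r) ('X - a%:P)).[z] * \sum_(a <- r) (z - a)^-1.
Proof.
elim: r => [|a r IHr]; first by rewrite !big_nil derivC horner0 mulr0.
rewrite inE negb_or => /andP[za /IHr {}IHr].
rewrite !big_cons derivM derivXsubC mul1r hornerD !hornerM IHr hornerXsubC.
have nz : z - a != 0 by rewrite subr_eq0.
by field.
Qed.

(** The Gauss-Lucas argument: 1 / (z - a) is the positive number
    1 / |z - a| ^ 2 times conj z - a, so a zero of the sum makes conj z a weighted
    average of the real numbers a. *)
Lemma real_sum_inv (C : numClosedFieldType) (r : seq C) (z : C) :
  r != [::] -> {in r, forall a, a \is Num.real} -> z \notin r ->
  \sum_(a <- r) (z - a)^-1 = 0 -> z \is Num.real.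
Proof.
move=> r0 rR zr sum0.
have nz a : a \in r -> 0 < `|z - a| ^- 2.
  move=> ar; rewrite invr_gt0 exprn_gt0// normr_gt0 subr_eq0.
  by apply: contraNneq zr => ->.
pose W : C := \sum_(a <- r) `|z - a| ^- 2.
have W0 : 0 < W.
  rewrite /W; case: r r0 nz {rR zr sum0 W} => // a r _ nz.
  rewrite big_cons ltr_pwDl ?nz ?mem_head// big_seq; apply: sumr_ge0 => b br.
  by apply: (Order.POrderTheory.ltW (nz b _)); rewrite inE br orbT.
have zW : z^* * W = \sum_(a <- r) a * `|z - a| ^- 2.
  apply/eqP; rewrite -subr_eq0 mulr_sumr -sumrB -[X in _ == X]sum0; apply/eqP.
  rewrite big_seq [RHS]big_seq; apply: eq_bigr => a ar.
  rewrite -mulrBl invC_norm rmorphB/= (CrealP (rR a ar)).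
  by rewrite mulrC.
have WR : W \is Num.real by exact: gtr0_real.
suff zR : z^* \is Num.real by rewrite -(conjCK z) (CrealP zR).
rewrite (canRL (mulfK (lt0r_neq0 W0)) zW).
rewrite realM ?realV// big_seq; apply: sum_real => a ar.
by apply: realM; [exact: rR|exact: gtr0_real (nz a ar)].
Qed.

(** A root z of p' that is not a root of p cancels the logarithmic derivative
    p' / p, which is the sum of the 1 / (z - a) over the roots a of p. *)
Lemma real_rooted_deriv (C : numClosedFieldType) (p : {poly C}) :
  real_rooted p -> real_rooted p^`().
Proof.
move=> pR dp0 z dpz.
have p0 : p != 0 by apply: contraNneq dp0 => ->; rewrite deriv0.
have [|pz] := boolP (root p z); first exact: pR.
have [r pE] := closed_field_poly_normal p.
have c0 : lead_coef p != 0 by rewrite lead_coef_eq0.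
have rR : {in r, forall a, a \is Num.real}.
  by move=> a ar; apply: pR => //; rewrite pE rootZ// root_prod_XsubC.
have zr : z \notin r by move: pz; rewrite pE rootZ// root_prod_XsubC.
apply: (real_sum_inv _ rR zr).
  by apply: contraNneq dp0 => rE; rewrite pE rE big_nil alg_polyC derivC.
move: dpz; rewrite pE derivZ rootZ// rootE horner_deriv_prod_XsubC//.
rewrite mulf_eq0 => /orP[|/eqP//].
by rewrite -[_ == 0]/(root _ _) root_prod_XsubC (negPf zr).
Qed.

Lemma real_rooted_derivn (C : numClosedFieldType) (p : {poly C}) (m : nat) :
  real_rooted p -> real_rooted p^`(m).
Proof.
move=> pR; elim: m => [//|m IHm]; rewrite derivnS.
exact: real_rooted_deriv.
Qed.

(** The reciprocal polynomial X ^ d p(1 / X), when p has degree at most d. *)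
Definition rev_poly (C : nzRingType) (d : nat) (p : {poly C}) : {poly C} :=
  \poly_(i < d.+1) p`_(d - i).

Lemma horner_rev_poly (F : fieldType) (d : nat) (p : {poly F}) (z : F) :
  (size p <= d.+1)%N -> z != 0 -> (rev_poly d p).[z] = z ^+ d * p.[z^-1].
Proof.
move=> sp z0; rewrite horner_poly (horner_coef_wide _ sp) mulr_sumr.
rewrite (reindex_inj rev_ord_inj)/=; apply: eq_bigr => i _.
have id : (i <= d)%N by rewrite -ltnS.
rewrite subSS subKn// exprB ?unitfE// exprVn; ring.
Qed.

Lemma real_rooted_rev_poly (C : numClosedFieldType) (d : nat) (p : {poly C}) :
  (size p <= d.+1)%N -> real_rooted p -> real_rooted (rev_poly d p).
Proof.
move=> sp pR rp0 z.
have p0 : p != 0.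
  apply: contraNneq rp0 => ->; apply/eqP/polyP => i.
  by rewrite coef_poly !coef0 if_same.
have [->|z0] := eqVneq z 0; first by rewrite rpred0.
rewrite rootE horner_rev_poly// mulf_eq0 expf_eq0 (negPf z0) andbF/=.
by move=> /(pR p0); rewrite rpredV.
Qed.

(** * Newton's inequalities *)

Lemma real_rooted_prod (C : numClosedFieldType) (s : seq C) :
  {in s, forall a, a \is Num.real} ->
  real_rooted (\prod_(a <- s) (1 + a%:P * 'X)).
Proof.
move=> sR _ z; elim: s sR => [|a s IHs] sR.
  by rewrite big_nil rootE hornerC oner_eq0.
rewrite big_cons rootM => /orP[|]; last first.
  by apply: IHs => b bs; apply: sR; rewrite inE bs orbT.
rewrite rootE !hornerE => /eqP az.
have a0 : a != 0.
  by apply: contra_eq_neq az => ->; rewrite mul0r addr0 oner_eq0.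
have -> : z = - a^-1.
  by apply: (mulfI a0); rewrite mulrN divff// -[RHS]addr0 -az; ring.
by rewrite rpredN rpredV sR ?mem_head.
Qed.

(** A quadratic a X^2 + b X + c with a root u satisfies
    b^2 - 4 a c = (2 a u + b)^2, which is nonnegative when u is real; no square
    root of the discriminant has to be taken. *)
Lemma real_rooted_discr (C : numClosedFieldType) (p : {poly C}) :
  (size p <= 3)%N -> {in (p : seq C), forall c, c \is Num.real} ->
  real_rooted p -> 4%:R * p`_0 * p`_2 <= p`_1 ^+ 2.
Proof.
move=> sp cR pR.
have {}cR i : p`_i \is Num.real.
  have [ip|ip] := ltnP i (size p); first by rewrite cR// mem_nth.
  by rewrite nth_default ?rpred0.
have [->|c2] := eqVneq p`_2 0; first by rewrite mulr0 real_exprn_even_ge0.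
have p0 : p != 0 by apply: contraNneq c2 => ->; rewrite coef0.
have sp3 : size p = 3%N.
  apply/eqP; rewrite eqn_leq sp ltnNge; apply: contra c2 => sp2.
  by rewrite nth_default.
have /closed_rootP[u pu] : size p != 1%N by rewrite sp3.
have uR := pR p0 u pu.
move: pu; rewrite rootE horner_coef sp3 !big_ord_recl big_ord0/= /bump/=.
rewrite !add1n expr0 expr1 mulr1 addr0 addr_eq0 => /eqP ->.
rewrite -subr_ge0.
have -> : p`_1 ^+ 2 - 4%:R * - (p`_1 * u + p`_2 * u ^+ 2) * p`_2 =
          (2%:R * p`_2 * u + p`_1) ^+ 2 by ring.
by rewrite real_exprn_even_ge0 ?realD ?realM ?realn.
Qed.

Lemma size_prod_1aX (C : idomainType) (s : seq C) :
  (size (\prod_(a <- s) (1 + a%:P * 'X))%R <= (size s).+1)%N.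
Proof.
elim: s => [|a s IHs]; first by rewrite big_nil size_polyC oner_eq0.
rewrite big_cons (leq_trans (size_polyMleq _ _))//=.
have sa : (size (1 + a%:P * 'X)%R <= 2)%N.
  rewrite addrC size_MXaddC; case: ifP => // _.
  by rewrite ltnS size_polyC leq_b1.
by rewrite -subn1 leq_subLR; exact: leq_add sa IHs.
Qed.

Lemma real_coef_prod_1aX (C : numClosedFieldType) (s : seq C) (i : nat) :
  {in s, forall a, a \is Num.real} ->
  (\prod_(a <- s) (1 + a%:P * 'X))`_i \is Num.real.
Proof.
elim: s i => [|a s IHs] i sR; first by rewrite big_nil coefC; case: ifP.
have {}IHs l : (\prod_(a <- s) (1 + a%:P * 'X))`_l \is Num.real.
  by apply: IHs => b bs; apply: sR; rewrite inE bs orbT.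
rewrite big_cons mulrDl mul1r -mulrA coefD coefCM coefXM.
apply: realD; first exact: IHs.
by apply: realM; [apply: sR; rewrite mem_head|case: ifP].
Qed.

(** The quadratic g below, obtained from prod (1 + a X) by j derivatives, a
    reversal in degree q + 2 and q derivatives, where q + 2 = size s - j, has as
    coefficients positive multiples of e_j, e_(j+1), e_(j+2), in decreasing
    degree. *)
Lemma newton_closed (C : numClosedFieldType) (s : seq C) (j : nat) :
  let e := (\prod_(a <- s) (1 + a%:P * 'X))%R in
  {in s, forall a, a \is Num.real} -> (j.+2 <= size s)%N ->
  (j.+2 * (size s - j))%N%:R * (e`_j * e`_j.+2) <=
  (j.+1 * (size s - j.+1))%N%:R * e`_j.+1 ^+ 2.
Proof.
move=> e sR js.
pose q := (size s - j.+2)%N.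
have sE : size s = (j + q.+2)%N by rewrite /q; lia.
have eR i : e`_i \is Num.real.
  by apply: real_coef_prod_1aX.
pose g := (rev_poly q.+2 e^`(j))^`(q).
have gE i : (i <= 2)%N -> g`_i =
    (e`_(j + (2 - i))) *+ ((j + (2 - i)) ^_ j * (q + i) ^_ q).
  move=> i2; rewrite coef_derivn coef_poly ifT; last by lia.
  rewrite coef_derivn mulrnA; congr (_`_ _ *+ _ ^_ _ *+ _); lia.
have sg : (size g <= 3)%N.
  apply/leq_sizeP => i i3; rewrite coef_derivn coef_poly ifF ?mul0rn//.
  by apply/negbTE; rewrite -leqNgt -addn3 leq_add2l.
have gR : real_rooted g.
  apply: real_rooted_derivn; apply: real_rooted_rev_poly.
    apply/leq_sizeP => i iq; rewrite coef_derivn nth_default ?mul0rn//.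
    by rewrite (leq_trans (size_prod_1aX s))// sE; lia.
  by apply: real_rooted_derivn; apply: real_rooted_prod.
have cR : {in (g : seq C), forall c, c \is Num.real}.
  move=> c /(nthP 0)[i ig <-]; rewrite gE; last exact: leq_trans ig sg.
  by rewrite -mulr_natr realM ?realn.
have := real_rooted_discr sg cR gR.
rewrite !gE// !subn0 subn1 subnn !addn0 !addn1 !addn2.
have f1 m : (m.+1 ^_ m = m.+1 * m`!)%N.
  by rewrite -(muln1 (_ ^_ _)) -[1%N]/(1`!) -[1%N](subSnn m) ffact_fact ?factS.
have f2 m : (2 * m.+2 ^_ m = m.+2 * m.+1 * m`!)%N.
  by rewrite mulnC -mulnA -!factS -(ffact_fact (leq_addl 2 m)) addnK.
have -> : (size s - j = q.+2)%N by lia.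
have -> : (size s - j.+1 = q.+1)%N by lia.
rewrite !ffactnn !f1.
(* K is the common factor of both sides of the discriminant inequality. *)
pose K : C := (j.+1 * q.+1 * (j`! * q`!) ^ 2)%N%:R.
have K0 : 0 < K by rewrite ltr0n !muln_gt0 !fact_gt0.
have -> : 4 * (e`_j.+2 *+ (j.+2 ^_ j * q`!)%N) * (e`_j *+ (j`! * q.+2 ^_ q)%N) =
    K * ((j.+2 * q.+2)%N%:R * (e`_j * e`_j.+2)).
  transitivity (((2 * j.+2 ^_ j) * (2 * q.+2 ^_ q) * (j`! * q`!))%N%:R *
                (e`_j * e`_j.+2)).
    by rewrite -(mulr_natr e`_j) -(mulr_natr e`_j.+2) !natrM; ring.
  by rewrite [RHS]mulrA -natrM !f2; congr (_%:R * _); lia.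
have -> : (e`_j.+1 *+ (j.+1 * j`! * (q.+1 * q`!))%N) ^+ 2 =
    K * ((j.+1 * q.+1)%N%:R * e`_j.+1 ^+ 2).
  rewrite -(mulr_natr e`_j.+1) exprMn mulrC [RHS]mulrA -natrX -natrM.
  by congr (_%:R * _); lia.
by rewrite ler_pM2l.
Qed.

(** In terms of the means p_j = e_j / binomial(N, j) this is the familiar
    p_j p_(j+2) <= p_(j+1)^2; the a in s may have any sign. *)
Lemma newton_ineq (R : rcfType) (s : seq R) (j : nat) :
  let e := (\prod_(a <- s) (1 + a%:P * 'X))%R in
  (j.+2 <= size s)%N ->
  (j.+2 * (size s - j))%N%:R * (e`_j * e`_j.+2) <=
  (j.+1 * (size s - j.+1))%N%:R * e`_j.+1 ^+ 2.
Proof.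
move=> e js; pose toC : {rmorphism R -> R[i]%C} := real_complex R.
have eC i : (\prod_(a <- map toC s) (1 + a%:P * 'X))`_i = toC e`_i.
  rewrite -coef_map rmorph_prod big_map; apply: (congr1 (coefp i)).
  apply: eq_bigr => a _.
  by rewrite rmorphD rmorphM/= rmorph1 map_polyC map_polyX.
have sR : {in map toC s, forall a, a \is Num.real}.
  by move=> _ /mapP[a _ ->]; rewrite complex_real.
have := newton_closed (j := j) sR; rewrite size_map => /(_ js).
rewrite !eC -rmorphXn/= -!rmorphM -!(rmorph_nat toC) -!rmorphM.
by rewrite lecR.
Qed.

(** Newton's inequality says that (j+1) e_(j+1) / ((N-j) e_j) is nonincreasing
    in j as long as the e_j are positive; compare the indices l and k.  Only e_0,
    ..., e_k are assumed positive, so the last entry e_(k+1) may have any sign. *)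
Lemma ratio_chain (R : realFieldType) (e : nat -> R) (N k l : nat) :
  (forall j, (j.+2 <= N)%N ->
     (j.+2 * (N - j))%N%:R * (e j * e j.+2) <=
     (j.+1 * (N - j.+1))%N%:R * e j.+1 ^+ 2) ->
  (forall j, (j <= k)%N -> 0 < e j) -> (l <= k < N)%N ->
  (k.+1 * (N - l))%N%:R * (e k.+1 * e l) <=
  (l.+1 * (N - k))%N%:R * (e k * e l.+1).
Proof.
move=> newt e0 /andP[lk].
elim: k lk e0 => [|k IHk].
  by rewrite leqn0 => /eqP-> _ _; rewrite [e 1%N * _]mulrC.
rewrite leq_eqVlt => /predU1P[-> _ _|lk e0 kN].
  by rewrite [e k.+2 * _]mulrC.
have {}IHk := IHk lk (fun j jk => e0 j (leqW jk)) (ltnW kN).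
have ek := e0 k (leqnSn _); have ek1 := e0 k.+1 (leqnn _).
have el := e0 l (leqW lk).
have newtk := newt k kN.
have c0 : 0 < (N - k)%N%:R * e k :> R by rewrite mulr_gt0// ltr0n subn_gt0 ltnW.
rewrite -(ler_pM2l c0).
have := ler_wpM2l (mulr_ge0 (ler0n _ (N - l)%N) (ltW el)) newtk.
have := ler_wpM2l (mulr_ge0 (ler0n _ (N - k.+1)%N) (ltW ek1)) IHk.
rewrite !natrM; lra.
Qed.

(** * Elementary symmetric functions with one variable removed *)

Lemma sigma_coef (R : realType) (n j : nat) (x : 'rV[R]_n) :
  sigma j x = (\prod_(i < n) (1 + (x 0 i)%:P * 'X))`_j.
Proof.
under eq_bigr do rewrite addrC.
rewrite bigA_distr coef_sum /sigma big_mkcond; apply: eq_bigr => A _.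
rewrite -big_mkcond big_split/= prodr_const -rmorph_prod coefCM coefXn.
by rewrite eq_sym; case: eqP; rewrite ?mulr1 ?mulr0.
Qed.

Lemma sigma_drop_coef (R : realType) (n j : nat) (x : 'rV[R]_n) (i : 'I_n) :
  sigma_drop j x i = (\prod_(p < n | p != i) (1 + (x 0 p)%:P * 'X))`_j.
Proof.
rewrite /sigma_drop sigma_coef (bigD1 i)//= mxE eqxx mul0r addr0 mul1r.
by under eq_bigr => p /negPf pi do rewrite mxE pi.
Qed.

Lemma sigma0E (R : realType) (n : nat) (x : 'rV[R]_n) : sigma 0 x = 1.
Proof.
rewrite sigma_coef -horner_coef0 horner_prod big1// => i _.
by rewrite !hornerE ?mulr0 ?addr0.
Qed.

(** sigma_(m-1)(x|i), with sigma_(-1) = 0: the partial derivative of sigma_m. *)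
Definition dsigma (R : realType) (n m : nat) (x : 'rV[R]_n) (i : 'I_n) : R :=
  if m is m'.+1 then sigma_drop m' x i else 0.

Lemma sigma_split (R : realType) (n m : nat) (x : 'rV[R]_n) (i : 'I_n) :
  sigma m x = sigma_drop m x i + x 0 i * dsigma m x i.
Proof.
rewrite sigma_coef (bigD1 i)//= mulrDl mul1r -mulrA coefD coefCM coefXM.
by rewrite -sigma_drop_coef; case: m => //= m; rewrite -sigma_drop_coef.
Qed.

(** Each m-subset A contributes its product once for every i outside A. *)
Lemma sigma_drop_sum (R : realType) (n m : nat) (x : 'rV[R]_n) :
  \sum_(i < n) sigma_drop m x i = (n - m)%:R * sigma m x.
Proof.
have dropE i : sigma_drop m x i =
    \sum_(A : {set 'I_n} | #|A| == m) (i \notin A)%:R * \prod_(p in A) x 0 p.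
  apply: eq_bigr => A _; have [iA|iA] := boolP (i \in A).
    by rewrite (bigD1 i)//= mxE eqxx !mul0r.
  rewrite mul1r; apply: eq_bigr => p pA; rewrite mxE ifN//.
  by apply: contraNneq iA => <-.
under eq_bigr do rewrite dropE.
rewrite exchange_big mulr_sumr; apply: eq_bigr => A /eqP Am.
rewrite -mulr_suml -natr_sum; congr (_%:R * _).
have -> : (n - m = #|~: A|)%N by rewrite cardsCs finset.setCK card_ord Am.
rewrite -sum1_card [RHS]big_mkcond; apply: eq_bigr => i _.
by rewrite inE; case: (i \in A).
Qed.

Lemma newton_sigma_drop (R : realType) (n j : nat) (x : 'rV[R]_n) (i : 'I_n) :
  (j.+2 <= n.-1)%N ->
  (j.+2 * (n.-1 - j))%N%:R * (sigma_drop j x i * sigma_drop j.+2 x i) <=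
  (j.+1 * (n.-1 - j.+1))%N%:R * sigma_drop j.+1 x i ^+ 2.
Proof.
pose s := [seq x 0 p | p <- enum (predC1 i)].
have ss : size s = n.-1 by rewrite size_map -cardE cardC1 card_ord.
rewrite -ss => js; have := newton_ineq js.
by rewrite !sigma_drop_coef /s big_map big_enum.
Qed.

(** By induction: sigma_m(x|i) = sigma_m(x) - x_i sigma_(m-1)(x|i), where both
    terms on the right contribute positively. *)
Lemma sigma_drop_gt0 (R : realType) (n k : nat) (x : 'rV[R]_n) (i : 'I_n) :
  Gamma k x -> x 0 i < 0 ->
  forall m, (m <= k)%N -> 0 < sigma_drop m x i.
Proof.
move=> xG xi; elim=> [_|m IHm mk]; first by rewrite /sigma_drop sigma0E.
have := xG m.+1 mk; rewrite (sigma_split _ _ i)/=.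
have := IHm (ltnW mk); nra.
Qed.

Lemma sigma_drop_oversize (R : realType) (n m : nat) (x : 'rV[R]_n) (i : 'I_n) :
  (n <= m)%N -> sigma_drop m x i = 0.
Proof.
move=> nm; rewrite /sigma_drop /sigma big1// => A /eqP Am.
have iA : i \in A.
  apply: contraTT nm => iA; rewrite -ltnNge -Am -[ltnRHS](card_ord n) -cardsT.
  by apply: proper_card; apply/properP; split; [exact: finset.subsetT|exists i].
by rewrite (bigD1 i)//= mxE eqxx mul0r.
Qed.

(** * Partial derivatives *)

Lemma is_derive_affine (R : realType) (V : normedModType R) (f : V -> R)
    (x v : V) (d : R) :
  (forall h : R, f (h *: v + x) = f x + h * d) -> is_derive x v f d.
Proof.
move=> fE.
have fd : (fun h => h^-1 *: ((f \o shift x) (h *: v) - f x)) @ 0^' --> d.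
  apply: cvg_near_cst; near=> h.
  have h0 : h != 0 by near: h; exact: nbhs_dnbhs_neq.
  by rewrite /= fE addrAC subrr add0r /GRing.scale/= mulrA mulVf// mul1r.
by apply: DeriveDef; [apply/cvg_ex; exists d|exact: cvg_lim].
Unshelve. all: by end_near. Qed.

(** sigma_m is affine in each variable. *)
Lemma is_derive_sigma (R : realType) (n m : nat) (x : 'rV[R]_n) (i : 'I_n) :
  is_derive x (delta_mx 0 i) (sigma m) (dsigma m x i).
Proof.
apply: is_derive_affine => h; rewrite !(sigma_split _ _ i).
have dropE j : sigma_drop j (h *: delta_mx 0 i + x) i = sigma_drop j x i.
  rewrite !sigma_drop_coef; congr (nth 0 (polyseq _) _).
  by apply: eq_bigr => p /negPf pi; rewrite !mxE pi andbF mulr0 add0r.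
have -> : dsigma m (h *: delta_mx 0 i + x) i = dsigma m x i.
  by case: m => //= m; exact: dropE.
by rewrite dropE !mxE !eqxx mulr1; ring.
Qed.

Lemma partial_quotient (R : realType) (n k l : nat) (x : 'rV[R]_n) (i : 'I_n) :
  sigma l x != 0 ->
  partial i (fun y => sigma k y / sigma l y) x =
  (dsigma k x i * sigma l x - sigma k x * dsigma l x i) / sigma l x ^+ 2.
Proof.
move=> sl0; have [dk Dk] := is_derive_sigma k x i.
have [dl Dl] := is_derive_sigma l x i.
rewrite /partial (deriveM dk (derivableV sl0 dl)) deriveV// Dk Dl.
rewrite /GRing.scale/=; by field.
Qed.

Lemma sum_partial_quotient (R : realType) (n k l : nat) (x : 'rV[R]_n) :
  sigma l x != 0 ->
  \sum_(i < n) partial i (fun y => sigma k y / sigma l y) x =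
  ((\sum_(i < n) dsigma k x i) * sigma l x -
   sigma k x * \sum_(i < n) dsigma l x i) / sigma l x ^+ 2.
Proof.
move=> sl0; under eq_bigr do rewrite partial_quotient//.
by rewrite -mulr_suml sumrB -mulr_suml -mulr_sumr.
Qed.

(** * The two inequalities *)

(* Indices are 0-based: i1 is the first index. *)
Theorem lemma2p5 (R : realType) (n k : nat) (hk : (1 <= k <= n)%N)
    (x : 'rV[R]_n) (hx : Gamma k x)
    (i1 : 'I_n) (hi1 : i1 = 0%N :> nat) (hx1 : x 0 i1 < 0) :
  (forall m : nat, (m <= k)%N -> sigma_drop m x i1 >= sigma m x) /\
  (forall l : nat, (l < k)%N ->
     partial i1 (fun y : 'rV[R]_n => sigma k y / sigma l y) x >=
     n%:R / k%:R * ((k%:R - l%:R) / (n%:R - l%:R)) * (1 / (n%:R - k%:R + 1)) *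
     \sum_(i < n) partial i (fun y : 'rV[R]_n => sigma k y / sigma l y) x).
Proof.
have t0 := sigma_drop_gt0 hx hx1.
have drop_ge m : (m <= k)%N -> sigma m x <= sigma_drop m x i1.
  move=> mk; rewrite (sigma_split _ _ i1) gerDl.
  case: m mk => [|m] mk /=; first by rewrite mulr0.
  by rewrite nmulr_rle0// ltW// t0// ltnW.
split=> // l lk.
have s0 m : (m <= k)%N -> 0 < sigma m x.
  by case: m => [|m] mk; [rewrite sigma0E|exact: hx].
(* For k = n the hypotheses are contradictory: sigma_n(x|1) = 0. *)
have kn : (k < n)%N.
  rewrite ltnNge; apply/negP => nk; have := t0 k (leqnn k).
  by rewrite sigma_drop_oversize ?ltxx.
case: k hk hx t0 drop_ge s0 lk kn => [//|k] hk hx t0 drop_ge s0 lk kn.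
have newt : (k.+1 * (n - l))%N%:R * (sigma_drop k.+1 x i1 * dsigma l x i1) <=
    (l * (n - k.+1))%N%:R * (sigma_drop k x i1 * sigma_drop l x i1).
  case: l lk => [|l] lk /=; first by rewrite !mulr0 !mul0r.
  have -> : (n - l.+1 = n.-1 - l)%N by lia.
  have -> : (n - k.+1 = n.-1 - k)%N by lia.
  apply: (ratio_chain (e := fun j => sigma_drop j x i1)); last by lia.
  - by move=> j; exact: newton_sigma_drop.
  - by move=> j jk; rewrite t0// leqW.
have sl := s0 l (ltnW lk).
have sumk : \sum_(i < n) dsigma k.+1 x i = (n%:R - k%:R) * sigma k x.
  by rewrite sigma_drop_sum natrB// ltnW// ltnW.
have suml : 0 <= \sum_(i < n) dsigma l x i.
  case: l lk {newt sl} => [|l] lk /=; first by rewrite big1.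
  rewrite sigma_drop_sum mulr_ge0//; apply: ltW; apply: s0; lia.
rewrite partial_quotient ?lt0r_neq0// sum_partial_quotient ?lt0r_neq0//.
rewrite [leLHS]mulrA ler_pM2r ?invr_gt0 ?exprn_gt0// sumk.
(* Expanding sigma_l and sigma_k+1 makes the terms in x_1 cancel. *)
rewrite [X in _ <= X * _ - _]/dsigma.
rewrite [in leRHS](sigma_split l x i1) [in leRHS](sigma_split k.+1 x i1)/=.
have skpos : 0 < sigma k x by rewrite s0// leqnSn.
have sk1pos : 0 < sigma k.+1 x by exact: s0.
have prodle : sigma k x * sigma l x <= sigma_drop k x i1 * sigma_drop l x i1.
  apply: ler_pM; [exact: ltW|exact: ltW|exact: drop_ge (leqnSn k)|].
  exact: drop_ge (ltnW lk).
have ln : (l <= n)%N by lia.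
move: newt; rewrite !natrM !natrB ?(ltnW kn)//.
have kl : (0 : R) <= k.+1%:R - l%:R by rewrite subr_ge0 ler_nat ltnW.
have nl : (0 : R) < n%:R - l%:R by rewrite subr_gt0 ltr_nat; lia.
have nk : (0 : R) < n%:R - k%:R by rewrite subr_gt0 ltr_nat; lia.
have k0 : (0 : R) < k.+1%:R by rewrite ltr0n.
have n0 : (0 : R) <= n%:R by rewrite ler0n.
have -> : n%:R - k.+1%:R + 1 = n%:R - k%:R :> R by rewrite -natr1; ring.
set K : R := k.+1%:R in k0 kl *; set L : R := l%:R in nl kl *.
set N : R := n%:R in nl nk n0 *.
move=> newt.
pose c := N / K * ((K - L) / (N - L)).
have c0 : 0 <= c.
  by rewrite /c; do ![apply: mulr_ge0]; rewrite ?invr_ge0 // ?(ltW nl).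
(* Drop the negative part of the sum of the partial derivatives. *)
apply: (@le_trans _ _ (c * (sigma k x * sigma l x))).
  rewrite -/c -mulrA ler_wpM2l//.
  rewrite mulrBr mul1r !mulrA mulVf ?lt0r_neq0// mul1r gerBl.
  by rewrite !mulr_ge0 ?invr_ge0 // ltW.
apply: (le_trans (ler_wpM2l c0 prodle)).
rewrite -(ler_pM2l (mulr_gt0 k0 nl)).
have -> : K * (N - L) * (c * (sigma_drop k x i1 * sigma_drop l x i1)) =
    N * (K - L) * (sigma_drop k x i1 * sigma_drop l x i1).
  by rewrite /c; field; rewrite !lt0r_neq0.
lra.
Qed.
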